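(* Let $A\in\mathrm{End}(\mathbb C^n\otimes\mathbb C^n)$ be an idempotent such that $P_A=1-2A$ satisfies the braid relation, and let $M$ be an $n\times n$ $A$-Manin matrix over $\mathfrak R$. Define in $\mathfrak R[[t]]$ $$S(t)=\sum_{k\ge0}t^k\,\mathrm{tr}_{1,\dots,k}S^{(k)}M_1\cdots M_k,\quad A(t)=\sum_{k\ge0}(-t)^k\,\mathrm{tr}_{1,\dots,k}A^{(k)}M_1\cdots M_k,\quad T(t)=\sum_{k\ge0}t^k\,\mathrm{tr}\,M^{[k+1]},$$ (the $k=0$ terms of $S(t),A(t)$ being $1$). Then $\partial_tA(t)=-A(t)T(t)$ and $\partial_tS(t)=T(t)S(t)$.
   Context: $\mathfrak R$ is an associative unital algebra over $\mathbb C$. $P_A$ satisfies $P_A^{(12)}P_A^{(23)}P_A^{(12)}=P_A^{(23)}P_A^{(12)}P_A^{(23)}$; with $P_A^2=1$, $s_i\mapsto P_A^{(i,i+1)}$ defines an action $\sigma\mapsto P_A^{\sigma}$ of $S_k$ on $(\mathbb C^n)^{\otimes k}$; $S^{(k)}=\frac1{k!}\sum_{\sigma}P_A^{\sigma}$, $A^{(k)}=\frac1{k!}\sum_\sigma\mathrm{sgn}(\sigma)P_A^{\sigma}$. $M_a$ is $M$ acting on the $a$-th tensor factor; $M$ is $A$-Manin if $AM_1M_2(1-A)=0$. $\mathrm{tr}_{1,\dots,k}$ is the full trace over $(\mathbb C^n)^{\otimes k}$ and $\mathrm{tr}$ the trace of an $n\times n$ matrix, with values in $\mathfrak R$. For $n\times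 n$ matrices $B,C$ over $\mathfrak R$, $B*C=\mathrm{tr}_1(P_AB_1C_2)$ (partial trace over the first factor). $M^{[0]}=1$, $M^{[1]}=M$, $M^{[k]}=M^{[k-1]}*M$ for $k>1$. $\partial_t$ is the formal derivative. *)

(* Defs.v *)
From HB Require Import structures.
From Stdlib Require Import ClassicalEpsilon.
From mathcomp Require Import all_boot all_order all_algebra all_fingroup.
From mathcomp Require Import complex.
From mathcomp Require Import Rstruct.
Set Implicit Arguments. Unset Strict Implicit. Unset Printing Implicit Defensive.
Import Order.TTheory GRing.Theory Num.Theory.
Local Open Scope ring_scope.

Definition CC : fieldType := complex Rdefinitions.R.

Section Defs.
Variable Rg : algType CC.
Variable n : nat.

(* Basis indices of (C^n)^{(x)k}: functions from the k tensor positions to 'I_n *)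
Definition tidx (k : nat) := {ffun 'I_k -> 'I_n}.

(* Operators on (C^n)^{(x)k} with entries in Rg (matrices indexed by tidx k) *)
Definition top (k : nat) := tidx k -> tidx k -> Rg.

Definition opmul k (X Y : top k) : top k := fun I J => \sum_(K : tidx k) X I K * Y K J.
Definition opone k : top k := fun I J => (I == J)%:R.
Definition opzero k : top k := fun _ _ => 0.
Definition opsub k (X Y : top k) : top k := fun I J => X I J - Y I J.

Definition trk k (X : top k) : Rg := \sum_(I : tidx k) X I I.

(* X : End(C^n (x) C^n) (an (n*n)x(n*n) complex matrix, with the basis
   e_i (x) e_j indexed by mxvec_index i j) acting on tensor factors a and b *)
Definition emb2 k (X : 'M[CC]_(n * n)) (a b : 'I_k) : top k := fun I J =>
  (X (mxvec_index (I a) (I b)) (mxvec_index (J a) (J b)))%:A *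
  \prod_(m : 'I_k | (m != a) && (m != b)) ((I m == J m)%:R : Rg).

(* M_a : the n x n matrix M acting on the a-th tensor factor *)
Definition emb1 k (M : 'M[Rg]_n) (a : 'I_k) : top k := fun I J =>
  M (I a) (J a) * \prod_(m : 'I_k | m != a) ((I m == J m)%:R : Rg).

Definition Mprod k (M : 'M[Rg]_n) : top k := \big[@opmul k/@opone k]_(a < k) emb1 M a.

Definition PA (A : 'M[CC]_(n * n)) : 'M[CC]_(n * n) := 1%:M - 2%:R *: A.

(* next position a+1 (only used when a.+1 < k) *)
Definition nxt k (a : 'I_k) : 'I_k := insubd a a.+1.

Definition Padj k (A : 'M[CC]_(n * n)) (a : 'I_k) : top k := emb2 (PA A) a (nxt a).

Definition valid_word k (w : seq 'I_k) := all (fun a : 'I_k => (a.+1 < k)%N) w.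
Definition word_perm k (w : seq 'I_k) : 'S_k := (\prod_(a <- w) tperm a (nxt a))%g.

(* P_A^sigma: the image of sigma under s_a |-> P_A^{(a,a+1)}, computed along
   some word in the adjacent transpositions representing sigma (well defined
   under the braid relation and P_A^2 = 1). *)
Definition Pperm k (A : 'M[CC]_(n * n)) (s : 'S_k) : top k :=
  let w := epsilon (inhabits [::])
             (fun w : seq 'I_k => valid_word w /\ word_perm w = s) in
  \big[@opmul k/@opone k]_(a <- w) Padj A a.

Definition Symk k (A : 'M[CC]_(n * n)) : top k := fun I J =>
  (k`!%:R^-1 : CC) *: \sum_(s : 'S_k) Pperm A s I J.
Definition Altk k (A : 'M[CC]_(n * n)) : top k := fun I J =>
  (k`!%:R^-1 : CC) *: \sum_(s : 'S_k) ((-1) ^+ odd_perm s : CC) *: Pperm A s I J.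

Definition manin (A : 'M[CC]_(n * n)) (M : 'M[Rg]_n) : Prop :=
  let A12 := emb2 A (ord0 : 'I_2) ord_max in
  opmul (opmul (opmul A12 (emb1 M ord0)) (emb1 M ord_max)) (opsub (@opone 2) A12)
  = @opzero 2.

Definition braid (P : 'M[CC]_(n * n)) : Prop :=
  let P12 := emb2 P (0 : 'I_3) 1 in
  let P23 := emb2 P (1 : 'I_3) 2 in
  opmul (opmul P12 P23) P12 = opmul (opmul P23 P12) P23.

(* B * C = tr_1 (P_A B_1 C_2), written out entrywise:
   (B * C)_{ij} = sum_{a,b,c} (P_A)_{(a,i),(b,c)} B_{ba} C_{cj} *)
Definition mstar (A : 'M[CC]_(n * n)) (B C : 'M[Rg]_n) : 'M[Rg]_n :=
  \matrix_(i, j) \sum_(a < n) \sum_(b < n) \sum_(c < n)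
     ((PA A) (mxvec_index a i) (mxvec_index b c))%:A * (B b a * C c j).

Fixpoint Mbr (A : 'M[CC]_(n * n)) (M : 'M[Rg]_n) (k : nat) : 'M[Rg]_n :=
  match k with
  | 0 => 1%:M
  | 1 => M
  | k'.+1 => mstar A (Mbr A M k') M
  end.

Definition fps := nat -> Rg.
Definition fps_mul (f g : fps) : fps := fun k => \sum_(i < k.+1) f i * g (k - i)%N.
Definition fps_opp (f : fps) : fps := fun k => - f k.
Definition fps_deriv (f : fps) : fps := fun k => f k.+1 *+ k.+1.

Definition Sser (A : 'M[CC]_(n * n)) (M : 'M[Rg]_n) : fps :=
  fun k => trk (opmul (@Symk k A) (@Mprod k M)).
Definition Aser (A : 'M[CC]_(n * n)) (M : 'M[Rg]_n) : fps :=
  fun k => (-1) ^+ k * trk (opmul (@Altk k A) (@Mprod k M)).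
Definition Tser (A : 'M[CC]_(n * n)) (M : 'M[Rg]_n) : fps :=
  fun k => \tr (Mbr A M k.+1).

End Defs.

(* Main.v *)
(* A word in the adjacent transpositions can be normalised with the Coxeter
   relations alone, so the operators P_A^sigma do not depend on the chosen words
   and S^(k), A^(k) are the elements [sym] of the algebra generated by +P_A and
   -P_A respectively.  The double coset identity
     m E_m = E_{m-1} + (m-1) E_{m-1} p_{m-2} E_{m-1},
   the relation M_1...M_N E_m = E_m M_1...M_N E_m (a consequence of the Manin
   property) and the cyclicity of the trace for scalar operators give
     N tr (E_N M_1...M_N) = sum_{m<N} tr (E_m p_{m} ... p_{N-2} M_1...M_N),
   and each summand factorises over the two blocks of tensor factors, the block
   carrying the cycle contributing tr M^{[N-m]}.  The identity for A(t) is the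
   one for S(t) read in the converse algebra with -P_A in place of P_A. *)
From HB Require Import structures.
From Stdlib Require Import FunctionalExtensionality ClassicalEpsilon.
From mathcomp Require Import all_boot all_order all_algebra all_fingroup.
From mathcomp Require Import complex Rstruct zify.
Require Import Defs.
Set Implicit Arguments. Unset Strict Implicit. Unset Printing Implicit Defensive.
Import GRing.Theory Num.Theory.
Local Open Scope ring_scope.

(** * Symmetrizers of Coxeter generators *)

(* Sum of the minimal right coset representatives p_{m-1} p_{m-2} ... p_{m-j},
   0 <= j <= m, of S_m in S_{m+1}. *)
Definition coset_sum (B : pzRingType) (p : nat -> B) := fix C m : B :=
  if m is m'.+1 then 1 + p m' * C m' else 1.

(* [p a] plays the role of the transposition (a, a+1) of the points 0, ..., m-1,
   and [r a] that of 1/(a+1). *)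
Definition sym (B : pzRingType) (r p : nat -> B) := fix E m : B :=
  if m is m'.+1 then r m' * E m' * coset_sum p m' else 1.

Lemma coset_sumS (B : pzRingType) (p : nat -> B) m :
  coset_sum p m.+1 = 1 + p m * coset_sum p m.
Proof. by []. Qed.

Lemma symS (B : pzRingType) (r p : nat -> B) m :
  sym r p m.+1 = r m * sym r p m * coset_sum p m.
Proof. by []. Qed.

(** Stated for a bare operation, so that it covers permutations, operators and converse rings alike.
    The [k] generators [p 0, ..., p (k-1)] are those of [S_(k+1)]. *)
Definition coxeter (X : Type) (e : X) (op : X -> X -> X) (p : nat -> X) k :=
  [/\ forall a, (a < k)%N -> op (p a) (p a) = e,
      forall a, (a.+1 < k)%N ->
        op (op (p a) (p a.+1)) (p a) = op (op (p a.+1) (p a)) (p a.+1)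
    & forall a b, (a.+1 < b)%N -> (b < k)%N -> op (p a) (p b) = op (p b) (p a)].

Definition inv_succ (B : pzRingType) (r : nat -> B) :=
  (forall m x, r m * x = x * r m) /\ (forall m, r m * m.+1%:R = 1).

Lemma coxeter_leq (X : Type) (e : X) op p k l :
  (l <= k)%N -> coxeter e op p k -> coxeter e op p l.
Proof.
move=> lk [p2 pb pc]; split=> [a al|a al|a b ab bl].
- by apply: p2; apply: leq_trans lk.
- by apply: pb; apply: leq_trans lk.
- by apply: pc => //; apply: leq_trans lk.
Qed.

Section Symmetrizer.
Variables (B : pzRingType) (r p : nat -> B).
Hypothesis r_inv : inv_succ r.

Notation E := (sym r p).
Notation C := (coset_sum p).

Let rC m x : r m * x = x * r m. Proof. exact: r_inv.1. Qed.
Let rK m x : r m * (x *+ m.+1) = x.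
Proof. by rewrite -mulr_natl mulrA r_inv.2 mul1r. Qed.

Lemma mulrn_inv_succ m x : r m * x *+ m.+1 = x.
Proof. by rewrite -mulrnAr rK. Qed.

Lemma coset_sum_absorbl m x :
  (forall a, (a < m)%N -> p a * x = x) -> C m * x = x *+ m.+1.
Proof.
elim: m => [|m IH] px; first by rewrite mul1r.
rewrite /= mulrDl mul1r -mulrA IH => [|a am]; last by rewrite px // ltnS ltnW.
by rewrite mulrnAr px // -mulrS.
Qed.

Lemma coset_sum_absorbr m x :
  (forall a, (a < m)%N -> x * p a = x) -> x * C m = x *+ m.+1.
Proof.
elim: m => [|m IH] xp; first by rewrite mulr1.
rewrite /= mulrDr mulr1 mulrA xp // IH => [|a am]; last by rewrite xp // ltnS ltnW.
by rewrite -mulrS.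
Qed.

Lemma sym_absorbl m x :
  (forall a, (a.+1 < m)%N -> p a * x = x) -> E m * x = x.
Proof.
elim: m => [|m IH] px; first by rewrite mul1r.
rewrite /= -mulrA coset_sum_absorbl // -mulrA mulrnAr rK IH // => a am.
by rewrite px // ltnW.
Qed.

Lemma sym_absorbr m x :
  (forall a, (a.+1 < m)%N -> x * p a = x) -> x * E m = x.
Proof.
elim: m => [|m IH] xp; first by rewrite mulr1.
have xE : x * E m = x by apply: IH => a am; rewrite xp // ltnW.
by rewrite /= !mulrA -rC -(mulrA (r m)) xE -mulrA coset_sum_absorbr // rK.
Qed.

Lemma comm_coset_sum m x :
  (forall a, (a < m)%N -> GRing.comm x (p a)) -> GRing.comm x (C m).
Proof.
elim: m => [|m IH] xp; first exact: commr1.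
apply: commrD; first exact: commr1.
by apply: commrM; [exact: xp | apply: IH => a am; apply/xp/ltnW].
Qed.

Lemma comm_sym m x :
  (forall a, (a.+1 < m)%N -> GRing.comm x (p a)) -> GRing.comm x (E m).
Proof.
elim: m => [|m IH] xp; first exact: commr1.
apply: commrM; last exact: comm_coset_sum.
apply: commrM; first by rewrite /GRing.comm rC.
by apply: IH => a am; apply/xp/ltnW.
Qed.

Lemma coset_sum_invr m y : coxeter 1 *%R p m ->
  (forall a, (a.+1 < m)%N -> y * p a = y) ->
  forall a, (a < m)%N -> y * C m * p a = y * C m.
Proof.
elim: m y => [//|m IH] y [p2 pb pc] yp a; rewrite ltnS leq_eqVlt => /predU1P[->|am] /=.
  case: m {IH} p2 pb pc yp => [|m] p2 pb pc yp /=.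
    by rewrite mulr1 -mulrA mulrDl mul1r p2 // [p 0%N + 1]addrC.
  have pC : GRing.comm (p m.+1) (C m).
    by apply: comm_coset_sum => b bm; rewrite /GRing.comm -pc.
  have -> : y * (1 + p m.+1 * (1 + p m * C m)) * p m.+1 =
      y * p m.+1 + y * (p m.+1 * p m.+1) + y * (p m.+1 * p m * p m.+1) * C m.
    by rewrite !(mulrDr, mulrDl) !mulr1 -!mulrA -pC -addrA.
  rewrite p2 // mulr1 -pb // !mulrA (yp m) //.
  by rewrite !mulrDr !mulr1 !mulrA [y + (_ + _)]addrA [y + _]addrC.
have cm : coxeter 1 *%R p m by apply: (@coxeter_leq _ _ _ _ m.+1).
rewrite mulrDr mulr1 mulrDl (yp a am) mulrA IH // => b bm.
by rewrite -mulrA -pc // mulrA yp // ltnW.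
Qed.

Lemma sym_invr m a : coxeter 1 *%R p m.-1 -> (a.+1 < m)%N -> E m * p a = E m.
Proof.
elim: m a => [//|m IH] a cp am /=.
rewrite -!mulrA; congr (_ * _); rewrite mulrA; apply: coset_sum_invr => // b bm.
by apply: IH => //; apply: coxeter_leq cp; apply: leq_pred.
Qed.

End Symmetrizer.

(** * Converse rings, two-sided invariance and the double coset recursion *)

Lemma coxeter_converse (B : pzRingType) (p : nat -> B) k :
  coxeter 1 *%R p k -> coxeter 1 *%R (p : nat -> B^c) k.
Proof.
case=> p2 pb pc; split=> // [a ak|a b ab bk]; last exact/esym/pc.
by rewrite -[LHS]/(p a * (p a.+1 * p a)) -[RHS]/(p a.+1 * (p a * p a.+1)) !mulrA pb.
Qed.

Lemma inv_succ_converse (B : pzRingType) (r : nat -> B) :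
  inv_succ r -> inv_succ (r : nat -> B^c).
Proof.
move=> [rC rK]; split=> [m x|m]; first exact: (esym (rC m x)).
by have := rK m; rewrite !mulr_natr => rm; transitivity (1 : B); rewrite -?rm.
Qed.

Section SymmetrizerTheory.
Variables (B : pzRingType) (r p : nat -> B).
Hypothesis r_inv : inv_succ r.
Notation E := (sym r p).

(* Both sides E' and E satisfy E E' = E (right invariance of E) and
   E E' = E' (left invariance of E'). *)
Lemma sym_converse m : coxeter 1 *%R p m.-1 ->
  @sym B^c r p m = E m.
Proof.
move=> cp; have rc := inv_succ_converse r_inv; have cpc := coxeter_converse cp.
have <- : E m * (@sym B^c r p m : B) = E m.
  exact: (@sym_absorbl B^c r p rc m (E m) (fun a am => sym_invr r cp am)).
symmetry; apply: (@sym_absorbl B r p r_inv m (@sym B^c r p m)) => a am.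
exact: (@sym_invr B^c r p m a cpc am).
Qed.

Lemma sym_invl m a : coxeter 1 *%R p m.-1 -> (a.+1 < m)%N -> p a * E m = E m.
Proof.
move=> cp am; rewrite -sym_converse //.
exact: (@sym_invr B^c r p m a (coxeter_converse cp) am).
Qed.

(** Write [E m.+2] as [E m.+2 * E m.+1] and expand the first factor along [1 + p m * C m], with [C]
    the coset sum: the [m.+1] terms of [C m] are all absorbed by [E m.+1] on their right. *)
Lemma sym_double_coset m : coxeter 1 *%R p m.+1 ->
  E m.+2 *+ m.+2 = E m.+1 + E m.+1 * p m * E m.+1 *+ m.+1.
Proof.
move=> cp; have cp' := coxeter_leq (leqnSn m) cp.
have EE : E m.+2 * E m.+1 = E m.+2.
  by apply: sym_absorbr => // a am; apply: sym_invr => //; apply: ltnW.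
have idE : E m.+1 * E m.+1 = E m.+1.
  by apply: sym_absorbr => // a am; apply: sym_invr.
rewrite -EE (symS _ _ m.+1) -!(mulrA (r _)) mulrn_inv_succ //.
rewrite -mulrA coset_sumS mulrDl mul1r mulrDr idE -(mulrA (p m)).
rewrite (@coset_sum_absorbl _ _ m) => [|a am]; last exact: sym_invl.
by rewrite !mulrnAr !mulrA.
Qed.

End SymmetrizerTheory.

Lemma sym_rmorph (B B' : pzRingType) (f : {rmorphism B -> B'}) (r p : nat -> B)
    (r' p' : nat -> B') m :
  (forall a, f (r a) = r' a) -> (forall a, (a.+1 < m)%N -> f (p a) = p' a) ->
  f (sym r p m) = sym r' p' m.
Proof.
move=> fr; elim: m => [|m IH] fp; first exact: rmorph1.
rewrite /= !rmorphM fr IH => [|a am]; last by apply/fp/ltnW.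
congr (_ * _); elim: m fp {IH} => [|m IH] fp; first exact: rmorph1.
by rewrite /= rmorphD rmorph1 rmorphM fp // IH // => a am; apply/fp/ltnW.
Qed.

(** Reversing the order of the generators does not change the symmetrizer: each version is invariant
    under all generators, so their product equals both of them. *)
Lemma sym_rev (B : pzRingType) (r p q : nat -> B) m :
  inv_succ r -> coxeter 1 *%R p m.-1 -> coxeter 1 *%R q m.-1 ->
  (forall a, (a.+1 < m)%N -> q a = p (m.-2 - a)%N) -> sym r q m = sym r p m.
Proof.
move=> r_inv cp cq qE.
have pE a : (a.+1 < m)%N -> p a = q (m.-2 - a)%N.
  by case: m {cp cq} qE => [|[|m]] //= qE am; rewrite qE ?subKn // !ltnS leq_subr.
have lt a : (a.+1 < m -> (m.-2 - a).+1 < m)%N.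
  by case: m {cp cq qE pE} => [|[|m]] //= am; rewrite !ltnS leq_subr.
rewrite -[LHS](@sym_absorbr _ r p _ m) // => [|a am]; last first.
  by rewrite pE // sym_invr // lt.
by apply: sym_absorbl => // a am; rewrite qE // sym_invl // lt.
Qed.

(** * The Newton recursion for an abstract trace *)

Section Newton.
Variables (B : pzRingType) (r q : nat -> B) (N : nat).
Hypotheses (r_inv : inv_succ r) (cq : coxeter 1 *%R q N.-1).
Variables (V : zmodType) (tr : B -> V).
Hypothesis trD : {morph tr : x y / x + y}.
(** Cyclicity is asked against generators only: operators whose entries do not commute have no
    cyclic trace in general. *)
Hypothesis trC : forall a x, (a.+1 < N)%N -> tr (q a * x) = tr (x * q a).
Variable M : B.
Hypothesis qM : forall a, (a.+1 < N)%N -> q a * M * (1 + q a) = M * (1 + q a).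
(** [Pi m] stands for [q (m-1) * q m * ... * q (N-2)] when [0 < m <= N]; the value [Pi 0] is free
    and only ever occurs with multiplicity 0. *)
Variable Pi : nat -> B.
Hypotheses (PiN : Pi N = 1)
  (PiS : forall m, (m.+1 < N)%N -> Pi m.+1 = q m * Pi m.+2).

Notation E := (sym r q).

Let cq_le m : (m <= N)%N -> coxeter 1 *%R q m.-1.
Proof. by move=> mN; apply: coxeter_leq cq; rewrite -!subn1 leq_sub2r. Qed.

Let trMn x m : tr (x *+ m) = tr x *+ m.
Proof.
elim: m => [|m IH]; last by rewrite !mulrS trD IH.
by apply: (addrI (tr 0)); rewrite !mulr0n -trD !addr0.
Qed.

Lemma tr_symC m x : (m <= N)%N -> tr (E m * x) = tr (x * E m).
Proof.
elim: m x => [|m IH] x mN; first by rewrite mul1r mulr1.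
have trC_coset_sum k y : (k <= m)%N -> tr (coset_sum q k * y) = tr (y * coset_sum q k).
  elim: k y => [|k IHk] y km; first by rewrite mul1r mulr1.
  rewrite /= mulrDl mulrDr !trD mul1r mulr1 -mulrA trC ?(leq_trans _ mN) //.
  by rewrite -mulrA IHk ?(ltnW km) // mulrA.
rewrite /= -!mulrA r_inv.1 -mulrA IH ?(ltnW mN) // -!mulrA trC_coset_sum //.
by rewrite -!mulrA (r_inv.1 m (E m * _)) -!mulrA.
Qed.

(** Only generators [q b] with [m <= b] occur in [Pi m.+1], all of them far from [q a]; the
    induction is on [N - m]. *)
Lemma comm_Pi m a : (m < N)%N -> (a.+1 < m)%N -> GRing.comm (q a) (Pi m.+1).
Proof.
move=> mN; have [d dN] : exists d, N = (m + d.+1)%N.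
  by exists (N - m.+1)%N; rewrite addnS -addSn subnKC.
elim: d m {mN} dN => [|d IH] m dN am; first by rewrite -addn1 -dN PiN; apply: commr1.
rewrite PiS; last by rewrite dN !addnS !ltnS leq_addr.
apply: commrM; last by apply: (IH m.+1); [rewrite dN addSnnS | exact: ltnW].
case: cq => _ _ cq3; apply: cq3 => //.
by rewrite dN !addnS /= ltnS leq_addr.
Qed.

(** On [E m] the factor [1 + q a] of [qM] acts as 2; dividing by 2, that is multiplying by [r 1],
    shows that [q a] fixes [M * E m] from the left. *)
Lemma sym_manin m : (m <= N)%N -> E m * M * E m = M * E m.
Proof.
move=> mN; rewrite -mulrA; apply: sym_absorbl => // a am.
have aN := leq_trans am mN.
have qE : q a * E m = E m by apply: sym_invl => //; apply: cq_le.
have := congr1 (fun x => x * E m) (qM aN).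
rewrite -!mulrA mulrDl mul1r qE -!mulr2n !mulrnAr => /(congr1 (fun x => r 1 * x)).
by rewrite -!mulrnAr !mulrnAr !mulrn_inv_succ.
Qed.

(** The first double coset term is already in the required form. In the second, [E] commutes with
    [Pi m.+2], the middle [q m] completes it to [Pi m.+1], and the remaining [E] is cycled around
    the trace and removed by [sym_manin]. *)
Lemma newton_step m : (m < N)%N ->
  tr (E m.+1 * Pi m.+1 * M) *+ m.+1 =
  tr (E m * Pi m.+1 * M) + tr (E m * Pi m * M) *+ m.
Proof.
case: m => [|m] mN.
  have r0 : r 0%N = 1 by have := mulrn_inv_succ r_inv 0 1; rewrite mulr1n mulr1.
  by rewrite mulr0n addr0 mulr1n symS r0 !mul1r.
have mN' := ltnW mN; have cqm := cq_le mN.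
rewrite -trMn -2!mulrnAl sym_double_coset // 2!mulrDl trD; congr (_ + _).
have EPi : GRing.comm (Pi m.+2) (E m.+1).
  by apply: comm_sym => // a am; apply/commr_sym/comm_Pi.
have EME := sym_manin mN'; have trE x := tr_symC x mN'.
move: (E m.+1) EPi EME trE => e EPi EME trE.
rewrite !mulrnAl trMn; congr (_ *+ _).
rewrite -!mulrA (mulrA e (Pi m.+2)) -EPi -!mulrA (mulrA (q m)) -PiS //.
by rewrite !trE -!mulrA (mulrA e M) EME.
Qed.

Theorem newton :
  tr (E N * M) *+ N = \sum_(m < N) tr (E m * Pi m.+1 * M).
Proof.
suff H m : (m <= N)%N ->
    tr (E m * Pi m * M) *+ m = \sum_(i < m) tr (E i * Pi i.+1 * M).
  by rewrite -H // PiN mulr1.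
elim: m => [|m IH] mN; first by rewrite big_ord0.
by rewrite newton_step // big_ord_recr /= IH ?(ltnW mN) // addrC.
Qed.

End Newton.

(** * Words in the adjacent transpositions *)

Section Words.
Local Open Scope nat_scope.

(** The word [m-1, m-2, ..., m-j] of the minimal coset representatives summed in [coset_sum]. *)
Fixpoint desc_word (m j : nat) : seq nat :=
  match m, j with m'.+1, j'.+1 => m' :: desc_word m' j' | _, _ => [::] end.

Lemma desc_word0 m : desc_word m 0 = [::]. Proof. by case: m. Qed.

Lemma desc_word_all m j : all (fun a => a < m) (desc_word m j).
Proof.
elim: m j => [|m IH] [|j] //=; rewrite ltnSn /=.
by apply: sub_all (IH j) => a; apply: ltnW.
Qed.

(** Equality in the Coxeter monoid, expressed through all of its models instead of a
    presentation. *)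
Definition word_equiv k (w w' : seq nat) := forall (X : Type) (e : X)
  (op : Monoid.law e) (p : nat -> X), coxeter e op p k ->
  \big[op/e]_(a <- w) p a = \big[op/e]_(a <- w') p a.

(* [Monoid.mulmA] with [op] seen as a [Monoid.law], not as a [SemiGroup.law]. *)
Lemma lawA (X : Type) (e : X) (op : Monoid.law e) :
  associative (op : X -> X -> X).
Proof. exact: Monoid.mulmA. Qed.

Lemma comm_word (X : Type) (e : X) (op : Monoid.law e) (p : nat -> X) x w :
  (forall a, a \in w -> op (p a) x = op x (p a)) ->
  op (\big[op/e]_(a <- w) p a) x = op x (\big[op/e]_(a <- w) p a).
Proof.
elim: w => [|b w IH] px; first by rewrite big_nil Monoid.mul1m Monoid.mulm1.
rewrite big_cons -lawA IH => [|a aw]; last by apply: px; rewrite inE aw orbT.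
by rewrite !lawA px // mem_head.
Qed.

(** A generator acting on the right of a coset representative either yields another representative
    or moves to the left as a letter of the smaller group. *)
Lemma desc_word_rcons m j i : j <= m -> i < m -> exists v j',
  [/\ all (fun a => a.+1 < m) v, j' <= m
    & word_equiv m (rcons (desc_word m j) i) (v ++ desc_word m j')].
Proof.
elim: m j => [//|m IH] [|j] jm; rewrite ltnS leq_eqVlt => /predU1P[->|im].
- by exists [::], 1; split=> // X e op p _; rewrite /= desc_word0.
- by exists [:: i], 0; split; rewrite /= ?ltnS ?im.
- case: m jm {IH} => [|m] jm; first by
    exists [::], 0; split=> // X e op p [p2 _ _]; case: j jm => // _;
    rewrite /= !big_cons !big_nil Monoid.mulm1 p2.
  case: j jm => [|j] jm.
    exists [::], 0; split=> // X e op p [p2 _ _] /=.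
    by rewrite !big_cons !big_nil Monoid.mulm1 p2.
  (* The appended letter [m.+1] commutes back to the prefix [m.+1, m], and the braid relation turns
     [m.+1, m, m.+1] into [m, m.+1, m]. *)
  exists [:: m], j.+2; split=> [|//|X e op p [p2 pb pc]]; first by rewrite /= ltnSn.
  rewrite /= -cats1 !big_cons big_cat big_seq1 /= comm_word => [|a /(allP (desc_word_all _ _)) am].
    by rewrite !lawA pb.
  by apply: pc.
- have [v [j' [vm jm' vE]]] := IH j jm im.
  exists v, j'.+1; split=> // [|X e op p cp].
    by apply: sub_all vm => a; apply: ltnW.
  rewrite /= big_cons (vE X e op p (coxeter_leq (leqnSn m) cp)) !big_cat /=.
  rewrite big_cons !lawA comm_word // => a /(allP vm) am.
  by case: cp => _ _ pc; apply: pc.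
Qed.

Lemma word_normal_form m w : all (fun a => a < m) w -> exists u j,
  [/\ all (fun a => a.+1 < m) u, j <= m & word_equiv m w (u ++ desc_word m j)].
Proof.
elim/last_ind: w => [|w i IH]; first by exists [::], 0; split; rewrite ?desc_word0.
rewrite all_rcons => /andP[im /IH[u [j [um jm uE]]]].
have [v [j' [vm jm' vE]]] := desc_word_rcons jm im.
exists (u ++ v), j'; split=> // [|X e op p cp]; first by rewrite all_cat um.
rewrite -cats1 big_cat (uE X e op p cp) big_cat big_seq1 -lawA -catA [RHS]big_cat.
by rewrite -(vE X e op p cp) -cats1 big_cat big_seq1.
Qed.

Definition adj_tperm k (a : nat) : 'S_k.+1 := tperm (inord a) (inord a.+1).

Lemma coxeter_adj_tperm k : coxeter 1%g mulg (adj_tperm k) k.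
Proof.
have neq a b : a < k.+1 -> b < k.+1 -> a <> b -> inord a != inord b :> 'I_k.+1.
  by move=> ak bk ab; apply/eqP=> /(congr1 val) /=; rewrite !inordK.
have conj a b : (adj_tperm k a * b * adj_tperm k a = b ^ adj_tperm k a)%g.
  by rewrite /conjg tpermV mulgA.
split=> [a ak|a ak|a b ab bk]; first exact: tperm2.
- rewrite !conj /adj_tperm !tpermJ tpermR tpermL.
  by rewrite [in LHS]tpermD ?[in RHS]tpermD //; apply: neq; lia.
- apply/commgP/conjg_fixP; rewrite /adj_tperm tpermJ.
  by rewrite !tpermD //; apply: neq; lia.
Qed.

(** The Coxeter relations present the symmetric group. In normal form, the prefix fixes the last
    point and the descending word sends it to a position that determines its length; once the
    lengths agree, the descending words cancel and induction applies to the prefixes. *)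
Lemma adj_word_inj k m w1 w2 : m <= k ->
  all (fun a => a < m) w1 -> all (fun a => a < m) w2 ->
  (\prod_(a <- w1) adj_tperm k a = \prod_(a <- w2) adj_tperm k a)%g ->
  word_equiv m w1 w2.
Proof.
elim: m w1 w2 => [|m IH] w1 w2 mk; first by case: w1 w2 => // -[].
move=> /word_normal_form[u1 [j1 [um1 jm1 uE1]]] /word_normal_form[u2 [j2 [um2 jm2 uE2]]].
have cox := coxeter_leq mk (coxeter_adj_tperm k).
rewrite (uE1 _ _ _ _ cox) (uE2 _ _ _ _ cox) !big_cat => eqw.
have fixu u : all (fun a => a.+1 < m.+1) u ->
    (\prod_(a <- u) adj_tperm k a)%g (inord m.+1) = inord m.+1.
  elim: u => [|a u IHu] /=; first by rewrite big_nil perm1.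
  move=> /andP[am /IHu um]; rewrite big_cons permM tpermD //.
    by apply/eqP=> /(congr1 val)/=; rewrite !inordK //; lia.
  by apply/eqP=> /(congr1 val)/=; rewrite !inordK //; lia.
have desc_prod l j : j <= l -> l <= k ->
    (\prod_(a <- desc_word l j) adj_tperm k a)%g (inord l) = inord (l - j).
  elim: l j => [|l IHl] [|j] //=; rewrite ?big_nil ?perm1 ?subn0 // => jl lk.
  by rewrite big_cons permM tpermR IHl // ltnW.
have ej : j1 = j2.
  have /permP/(_ (inord m.+1)) := eqw; rewrite !permM (fixu _ um1) (fixu _ um2) !desc_prod //.
  by move=> /(congr1 val); rewrite /= !inordK; lia.
rewrite -ej in eqw uE2; have /mulIg eqw' := eqw.
move=> X e op p cp; rewrite (uE1 _ _ _ _ cp) (uE2 _ _ _ _ cp) !big_cat.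
by rewrite (IH u1 u2 (ltnW mk) um1 um2 eqw' X e op p (coxeter_leq (leqnSn m) cp)).
Qed.
End Words.

Lemma adj_word_ex k (s : 'S_k.+1) : exists2 w,
  all (fun a => a < k)%N w & (\prod_(a <- w) adj_tperm k a)%g = s.
Proof.
pose W s := exists2 w,
  all (fun a => a < k)%N w & (\prod_(a <- w) adj_tperm k a)%g = s.
have W1 : W 1%g by exists [::]; rewrite ?big_nil.
have WM s1 s2 : W s1 -> W s2 -> W (s1 * s2)%g.
  move=> [w1 w1k <-] [w2 w2k <-]; exists (w1 ++ w2); last by rewrite big_cat.
  by rewrite all_cat w1k.
have Wa a : (a < k)%N -> W (adj_tperm k a).
  by move=> ak; exists [:: a]; rewrite ?big_seq1 //= ak.
have Wt a d : (a + d <= k)%N -> W (tperm (inord a) (inord (a + d)%N)).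
  elim: d => [|d IH] adk; first by rewrite addn0 tperm1.
  have [->|d0] := eqVneq d 0%N; first by rewrite addn1; apply: Wa; lia.
  (* A longer transposition is the conjugate of one shorter by 1 under an adjacent transposition. *)
  have -> : tperm (inord a) (inord (a + d.+1)%N) =
      (adj_tperm k (a + d) * tperm (inord a) (inord (a + d)%N) * adj_tperm k (a + d))%g.
    rewrite -{1}[adj_tperm k (a + d)]tpermV -mulgA -conjgE tpermJ tpermL addnS tpermD //;
    by apply/eqP=> /(congr1 val) /=; rewrite !inordK; lia.
  by apply/WM/Wa; [apply: WM; [apply: Wa|apply: IH]|]; lia.
have [ts -> _] := prod_tpermP s; elim: ts => [|[x y] ts IH]; first by rewrite big_nil.
rewrite big_cons; apply: WM => //=.
wlog xy : x y / (x <= y)%N.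
  by case: (leqP x y) => [?|/ltnW ?] H; [|rewrite tpermC]; apply: H.
have := Wt x (y - x)%N; rewrite subnKC // !inord_val; apply.
by rewrite -ltnS.
Qed.

(** By [adj_word_inj] the sum is invariant under right multiplication by generators, so it equals
    its product with the symmetrizer; each word is absorbed there, leaving one copy per
    permutation. *)
Lemma sum_words (B : pzRingType) (r p : nat -> B) k (W : 'S_k.+1 -> seq nat) :
  inv_succ r -> coxeter 1 *%R p k ->
  (forall s, all (fun a => a < k)%N (W s) /\
     (\prod_(a <- W s) adj_tperm k a)%g = s) ->
  \sum_(s : 'S_k.+1) \prod_(a <- W s) p a = sym r p k.+1 *+ k.+1`!.
Proof.
move=> r_inv cp WP; set Q := \sum_s _.
have Qp a : (a.+1 < k.+1)%N -> Q * p a = Q.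
  rewrite ltnS => ak; rewrite [RHS](reindex_inj (mulIg (adj_tperm k a))) /= mulr_suml.
  apply: eq_bigr => s _; have [Wk Ws] := WP s.
  have [Wk' Ws'] := WP (s * adj_tperm k a)%g.
  have -> : \prod_(b <- W (s * adj_tperm k a)%g) p b = \prod_(b <- rcons (W s) a) p b.
    apply: (adj_word_inj (leqnn k)) cp => //; first by rewrite all_rcons ak.
    by rewrite Ws' -cats1 big_cat big_seq1 /= Ws.
  by rewrite -cats1 big_cat big_seq1.
rewrite -(sym_absorbr r_inv Qp) mulr_suml (eq_bigr (fun=> sym r p k.+1)).
  by rewrite sumr_const card_Sn.
move=> s _; have [+ _] := WP s; elim: (W s) => [|a w IH] /=; first by rewrite big_nil mul1r.
by move=> /andP[ak /IH wE]; rewrite big_cons -mulrA wE sym_invl.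
Qed.

(** * Operators on tensor powers *)

Section Operators.
Variables (Rg : algType CC) (n : nat).
Notation tidx := (tidx n).
Notation top := (top Rg n).

(** Matrices provide the ring structure on operators. Their size vanishes for [n = 0] and [0 < k],
    so the ring may be trivial; hence [pzRingType] in the abstract part. *)
Definition opmx k := 'M[Rg]_(#|{: tidx k}|).

Definition to_mx k (X : top k) : opmx k :=
  \matrix_(i, j) X (enum_val i) (enum_val j).
Definition of_mx k (X : opmx k) : top k :=
  fun I J => X (enum_rank I) (enum_rank J).

Lemma to_mxK k : cancel (@to_mx k) (@of_mx k).
Proof.
move=> X; do 2 apply: functional_extensionality => ?.
by rewrite /of_mx mxE !enum_rankK.
Qed.

Lemma of_mxK k : cancel (@of_mx k) (@to_mx k).
Proof. by move=> X; apply/matrixP=> i j; rewrite mxE /of_mx !enum_valK. Qed.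

Lemma of_mxP k (X Y : opmx k) : (forall I J, of_mx X I J = of_mx Y I J) -> X = Y.
Proof.
move=> XY; apply: (can_inj (@of_mxK k)).
by do 2 apply: functional_extensionality => ?; apply: XY.
Qed.

Lemma sum_enum_val k (F : tidx k -> Rg) :
  \sum_(i < #|{: tidx k}|) F (enum_val i) = \sum_I F I.
Proof.
rewrite [RHS](reindex_onto enum_val enum_rank) => [|i _]; rewrite ?enum_rankK //.
by apply: eq_bigl => i; rewrite enum_valK eqxx.
Qed.

Lemma to_mxM k (X Y : top k) : to_mx (opmul X Y) = to_mx X * to_mx Y.
Proof.
apply/matrixP=> i j; rewrite !mxE /opmul -sum_enum_val.
by apply: eq_bigr => l _; rewrite !mxE.
Qed.

Lemma to_mx1 k : to_mx (@opone Rg n k) = 1.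
Proof.
by apply/matrixP=> i j; rewrite !mxE /opone (inj_eq enum_val_inj).
Qed.

Lemma of_mxM k (X Y : opmx k) : of_mx (X * Y) = opmul (of_mx X) (of_mx Y).
Proof. by apply: (can_inj (@to_mxK k)); rewrite to_mxM !of_mxK. Qed.

Lemma of_mx1 k I J : of_mx (1 : opmx k) I J = (I == J)%:R.
Proof. by rewrite -to_mx1 to_mxK. Qed.

Lemma of_mxZ k a (X : opmx k) I J : of_mx (a *: X) I J = a * of_mx X I J.
Proof. by rewrite /of_mx mxE. Qed.

Lemma trk_to_mx k (X : top k) : trk X = \tr (to_mx X).
Proof. by rewrite /trk -sum_enum_val; apply: eq_bigr => i _; rewrite mxE. Qed.

Lemma tr_of_mx k (X : opmx k) : \tr X = \sum_I of_mx X I I.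
Proof. by rewrite -[X]of_mxK -trk_to_mx of_mxK. Qed.

Definition agree k (P : pred 'I_k) (I J : tidx k) :=
  [forall x, P x ==> (I x == J x)].

Lemma agreeP k (P : pred 'I_k) (I J : tidx k) :
  reflect (forall x, P x -> I x = J x) (agree P I J).
Proof. by apply: (iffP 'forall_implyP) => H x /H /eqP. Qed.

Lemma prod_agree k (P : pred 'I_k) (I J : tidx k) :
  \prod_(x | P x) ((I x == J x)%:R : Rg) = (agree P I J)%:R.
Proof.
have [/agreeP IJ|] := boolP (agree P I J).
  by apply: big1 => x /IJ ->; rewrite eqxx.
rewrite negb_forall => /existsP[x]; rewrite negb_imply => /andP[Px /negPf IJx].
suff H s : x \in s -> \prod_(y <- s | P y) ((I y == J y)%:R : Rg) = 0.
  by apply: H; rewrite mem_index_enum.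
elim: s => [//|y s IH]; rewrite inE big_cons => /predU1P[<-|/IH->].
  by rewrite Px IJx mul0r.
by rewrite mulr0 if_same.
Qed.

(** * Operators acting on a block of consecutive tensor factors *)

Section Embedding.
Variables (s m N : nat) (H : (s + m <= N)%N).

Lemma shift_subproof (i : 'I_m) : (s + i < N)%N.
Proof. by rewrite -addnS; apply: leq_trans H; rewrite leq_add2l. Qed.
Definition shift i := Ordinal (shift_subproof i).

Lemma shift_inj : injective shift.
Proof. by move=> i j [/addnI/val_inj]. Qed.

(* The tensor positions on which an operator embedded at offset [s] acts
   trivially. *)
Definition out (x : 'I_N) := x \notin codom shift.

Lemma outE x : out x = (x < s)%N || (s + m <= x)%N.
Proof.
apply/idP/idP => [|xs]; last first.
  by apply/negP=> /codomP[i ix]; have := ltn_ord i; move: xs; rewrite ix /=; lia.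
apply: contraR; rewrite negb_or -leqNgt -ltnNge => /andP[sx xm].
have xsm : (x - s < m)%N by lia.
by apply/codomP; exists (Ordinal xsm); apply: val_inj; rewrite /= subnKC.
Qed.

Lemma out_shift i : out (shift i) = false.
Proof. by rewrite /out codom_f. Qed.

Lemma outN x : ~~ out x -> {i | x = shift i}.
Proof. by rewrite negbK => xs; exists (iinv xs); rewrite f_iinv. Qed.

Definition pull (I : tidx N) : tidx m := [ffun i => I (shift i)].

Definition upd (I : tidx N) (L : tidx m) : tidx N :=
  [ffun x => if [pick i | shift i == x] is Some i then L i else I x].

Lemma pull_upd I L : pull (upd I L) = L.
Proof.
apply/ffunP=> i; rewrite !ffunE; case: pickP => [j /eqP/shift_inj ->//|/(_ i)].
by rewrite eqxx.
Qed.

Lemma upd_out I L x : out x -> upd I L x = I x.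
Proof.
move=> ox; rewrite ffunE; case: pickP => // j /eqP jx.
by move: ox; rewrite -jx out_shift.
Qed.

Lemma eq_pull (I J : tidx N) : pull I = pull J -> agree out I J -> I = J.
Proof.
move=> /ffunP pIJ /agreeP IJ; apply/ffunP=> x; case: (boolP (out x)) => [/IJ //|].
by move=> /outN[i ->]; have := pIJ i; rewrite !ffunE.
Qed.

(** The tensor product of [X], placed at positions [s, ..., s+m-1], with identities on all other
    factors. *)
Definition emb (X : opmx m) : opmx N :=
  to_mx (fun I J => of_mx X (pull I) (pull J) * (agree out I J)%:R).

Lemma embE X I J :
  of_mx (emb X) I J = of_mx X (pull I) (pull J) * (agree out I J)%:R.
Proof. by rewrite to_mxK. Qed.

Lemma emb_is_zmod_morphism : GRing.zmod_morphism emb.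
Proof.
move=> X Y; apply: of_mxP => I J.
by rewrite embE /of_mx !mxE -mulrBl !enum_rankK.
Qed.
HB.instance Definition _ := GRing.isZmodMorphism.Build _ _ emb emb_is_zmod_morphism.

Lemma embZ a X : emb (a *: X) = a *: emb X.
Proof. by apply: of_mxP => I J; rewrite of_mxZ !embE of_mxZ mulrA. Qed.

Lemma emb_is_monoid_morphism : GRing.monoid_morphism emb.
Proof.
split=> [|X Y]; apply: of_mxP => I J.
  rewrite embE !of_mx1 -natrM mulnb; congr (nat_of_bool _)%:R.
  apply/andP/eqP => [[/eqP pIJ oIJ]|->]; first exact: eq_pull.
  by split=> //; apply/agreeP.
rewrite embE !of_mxM /opmul mulr_suml.
rewrite [RHS](bigID (agree out I)) /= [X in _ + X]big1 ?addr0; last first.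
  by move=> K /negPf IK; rewrite !embE IK mulr0 mul0r.
(* The intermediate indices that contribute agree with [I] outside the block, so they are determined
   by their restriction to it. *)
rewrite [RHS](reindex_onto (upd I) pull) /=; last first.
  move=> K /agreeP IK; apply: eq_pull; first by rewrite pull_upd.
  by apply/agreeP=> x ox; rewrite upd_out // IK.
apply: eq_big => [L|L _].
  rewrite pull_upd eqxx andbT; symmetry; apply/agreeP => x ox.
  by rewrite upd_out.
rewrite !embE pull_upd; have -> : agree out I (upd I L).
  by apply/agreeP => x ox; rewrite upd_out.
rewrite mulr1 mulrA; congr (_ * (nat_of_bool _)%:R).
by apply/agreeP/agreeP => IJ x ox; have := IJ x ox; rewrite upd_out.
Qed.
HB.instance Definition _ :=
  GRing.isMonoidMorphism.Build _ _ emb emb_is_monoid_morphism.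

End Embedding.

Lemma emb_mul_disjoint N s1 m1 s2 m2 (H1 : (s1 + m1 <= N)%N) (H2 : (s2 + m2 <= N)%N)
    X Y I J :
  (forall x, out H1 x || out H2 x) ->
  of_mx (emb H1 X * emb H2 Y) I J =
  of_mx X (pull H1 I) (pull H1 J) * of_mx Y (pull H2 I) (pull H2 J) *
    (agree (predI (out H1) (out H2)) I J)%:R.
Proof.
(* [K0] is the only intermediate index that contributes: the first operator changes [I] into [J] on
   its own block only. *)
move=> dis; pose K0 : tidx N := [ffun x => if out H1 x then I x else J x].
rewrite of_mxM /opmul (bigD1 K0) //= big1 ?addr0 => [|K]; last first.
  rewrite !embE => KK0; case: (boolP (agree (out H1) I K)) => [/agreeP IK|]; last first.
    by move=> _; rewrite mulr0 mul0r.
  case: (boolP (agree (out H2) K J)) => [/agreeP KJ|]; last by rewrite !mulr0.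
  case/eqP: KK0; apply/ffunP=> x; rewrite ffunE; case: ifP => [/IK //|o1].
  by apply: KJ; have := dis x; rewrite o1.
have p1 : pull H1 K0 = pull H1 J.
  by apply/ffunP=> i; rewrite !ffunE out_shift.
have p2 : pull H2 K0 = pull H2 I.
  apply/ffunP=> i; rewrite !ffunE; case: ifP => // o1.
  by have := dis (shift H2 i); rewrite o1 out_shift.
rewrite !embE p1 p2; have -> : agree (out H1) I K0.
  by apply/agreeP => x o1; rewrite ffunE o1.
rewrite mulr1 mulrA; congr (_ * (nat_of_bool _)%:R).
apply/agreeP/agreeP => IJ x; last first.
  by move=> o2; rewrite ffunE; case: ifP => // o1; apply: IJ; rewrite /= o1.
by move=> /andP[o1 o2]; have := IJ x o2; rewrite ffunE o1.
Qed.

Lemma of_mx_scalarl k (a : Rg) (X : opmx k) I J :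
  of_mx ((a%:M : opmx k) * X) I J = a * of_mx X I J.
Proof. by rewrite -of_mxZ -mul_scalar_mx. Qed.

Lemma of_mx_scalarr k (a : Rg) (X : opmx k) I J :
  of_mx (X * (a%:M : opmx k)) I J = of_mx X I J * a.
Proof.
rewrite of_mxM /opmul (bigD1 J) //= big1 ?addr0 => [|K /negPf KJ].
  by rewrite {2}/of_mx mxE eqxx.
by rewrite {2}/of_mx mxE (inj_eq enum_rank_inj) KJ mulr0.
Qed.

(** Centrality concerns the entries, which commute with all of [Rg] (see [centralP]); the operator
    itself need not be central among operators. *)
Definition central k (X : opmx k) := forall a : Rg, GRing.comm (a%:M : opmx k) X.

Lemma centralP k (X : opmx k) :
  central X <-> (forall I J a, a * of_mx X I J = of_mx X I J * a).
Proof.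
split=> [cX I J a|cX a]; first by rewrite -of_mx_scalarl -of_mx_scalarr cX.
by apply: of_mxP => I J; rewrite of_mx_scalarl of_mx_scalarr cX.
Qed.

Lemma tr_mulC k (X Y : opmx k) : central X -> \tr (X * Y) = \tr (Y * X).
Proof.
move=> /centralP cX; rewrite !tr_of_mx of_mxM of_mxM /opmul exchange_big /=.
by apply: eq_bigr => I _; apply: eq_bigr => J _; rewrite cX.
Qed.

Lemma emb_scalar s m N (H : (s + m <= N)%N) (a : Rg) : emb H a%:M = a%:M.
Proof. by rewrite -[a%:M]scalemx1 embZ rmorph1 scalemx1. Qed.

Lemma emb_comm N s1 m1 s2 m2 (H1 : (s1 + m1 <= N)%N) (H2 : (s2 + m2 <= N)%N) X Y :
  (forall x, out H1 x || out H2 x) -> central X -> GRing.comm (emb H1 X) (emb H2 Y).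
Proof.
move=> dis /centralP cX; apply: of_mxP => I J.
rewrite !emb_mul_disjoint // => [|x]; last by rewrite orbC.
by rewrite cX; congr (_ * (nat_of_bool _)%:R); apply: eq_forallb => x; rewrite /= andbC.
Qed.

(** The trace of a tensor product is the product of the traces, in the order of the factors, because
    an index of the whole is a pair of indices of the two blocks. *)
Lemma tr_emb_mul N i j (H1 : (0 + i <= N)%N) (H2 : (i + j <= N)%N) X Y :
  N = (i + j)%N -> \tr (emb H1 X * emb H2 Y) = \tr X * \tr Y.
Proof.
move=> eN; subst N; rewrite !tr_of_mx mulr_suml.
under eq_bigr => I _.
  rewrite emb_mul_disjoint => [|x]; last by rewrite !outE; lia.
  have -> : agree (predI (out H1) (out H2)) I I by apply/agreeP.
  rewrite mulr1; over.
under [RHS]eq_bigr => I _ do rewrite mulr_sumr.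
rewrite pair_big /=.
pose jn (u : tidx i * tidx j) : tidx (i + j) :=
  [ffun x => match split x with inl a => u.1 a | inr b => u.2 b end].
have sl a : shift H1 a = lshift j a by apply: val_inj.
have sr a : shift H2 a = rshift i a by apply: val_inj.
have jn1 u : pull H1 (jn u) = u.1.
  by apply/ffunP=> a; rewrite !ffunE sl (unsplitK (inl a)).
have jn2 u : pull H2 (jn u) = u.2.
  by apply/ffunP=> a; rewrite !ffunE sr (unsplitK (inr a)).
rewrite (reindex_onto jn (fun I => (pull H1 I, pull H2 I))) /=; last first.
  move=> I _; apply/ffunP=> x; rewrite !ffunE; case: (splitP x) => a xa; rewrite !ffunE;
  by congr (I _); apply: val_inj; rewrite /= xa.
apply: eq_big => u; first by rewrite jn1 jn2 -surjective_pairing eqxx.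
by rewrite jn1 jn2.
Qed.

End Operators.

(** * The generators and the Manin relation *)

Section Generators.
Variables (Rg : algType CC) (n : nat).
Notation tidx := (tidx n).
Notation opmx := (opmx Rg n).

Lemma agree_pull s m N (H : (s + m <= N)%N) (P : pred 'I_m) (Q : pred 'I_N)
    (I J : tidx N) :
  (forall i, Q (shift H i) = P i) -> (forall x, out H x -> Q x) ->
  agree P (pull H I) (pull H J) && agree (out H) I J = agree Q I J.
Proof.
move=> QP oQ; apply/andP/agreeP => [[/agreeP pIJ /agreeP oIJ] x Qx|IJ].
  have [/oIJ//|/outN[i xi]] := boolP (out H x).
  by have := pIJ i; rewrite !ffunE xi; apply; rewrite -QP -xi.
split; apply/agreeP=> x; last by move=> /oQ/IJ.
by rewrite -QP !ffunE => /IJ.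
Qed.

Lemma emb_emb2 s m N (H : (s + m <= N)%N) (X : 'M[CC]_(n * n)) a b :
  emb H (to_mx (@emb2 Rg n m X a b)) = to_mx (emb2 Rg X (shift H a) (shift H b)).
Proof.
apply: of_mxP => I J; rewrite embE !to_mxK /emb2 !prod_agree !ffunE -mulrA.
rewrite -natrM mulnb (agree_pull (Q := fun x => (x != shift H a) && (x != shift H b))) //.
  by move=> i; rewrite !(inj_eq (@shift_inj _ _ _ H)).
by move=> x ox; apply/andP; split; apply/eqP=> xa; rewrite xa out_shift in ox.
Qed.

Lemma emb_emb1 s m N (H : (s + m <= N)%N) (M : 'M[Rg]_n) a :
  emb H (to_mx (@emb1 Rg n m M a)) = to_mx (emb1 M (shift H a)).
Proof.
apply: of_mxP => I J; rewrite embE !to_mxK /emb1 !prod_agree !ffunE -mulrA.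
rewrite -natrM mulnb (agree_pull (Q := fun x => (x != shift H a))) //.
  by move=> i; rewrite !(inj_eq (@shift_inj _ _ _ H)).
by move=> x ox; apply/eqP=> xa; rewrite xa out_shift in ox.
Qed.

Lemma central_emb2 N (X : 'M[CC]_(n * n)) a b : central (to_mx (@emb2 Rg n N X a b)).
Proof.
apply/centralP=> I J x; rewrite to_mxK /emb2 prod_agree.
by rewrite !mulr_natr mulrnAr mulrnAl mulr_algl mulr_algr.
Qed.

(* The value outside of ['I_N] is irrelevant. *)
Definition pos N (F : 'I_N -> opmx N) (a : nat) : opmx N := oapp F 1 (insub a).

Lemma posE N F (a : 'I_N) : pos F a = F a.
Proof. by rewrite /pos valK. Qed.

Lemma emb_pos s m N (H : (s + m <= N)%N) F G a : (a < m)%N ->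
  (forall i : 'I_m, val i = a -> emb H (F i) = G (shift H i)) ->
  emb H (pos F a) = pos G (s + a).
Proof.
move=> am FG; rewrite -[a in pos F a]/(val (Ordinal am)) posE FG //.
by rewrite -[(s + a)%N]/(val (shift H (Ordinal am))) posE.
Qed.

Definition mat N (M : 'M[Rg]_n) := pos (fun x : 'I_N => to_mx (emb1 M x)).

Lemma emb_mat s m N (H : (s + m <= N)%N) M a : (a < m)%N ->
  emb H (mat m M a) = mat N M (s + a).
Proof. by move=> am; apply: emb_pos => // i _; rewrite emb_emb1. Qed.

Definition matprod N (M : 'M[Rg]_n) := \prod_(0 <= a < N) mat N M a.

Lemma emb_matprod s m N (H : (s + m <= N)%N) M :
  emb H (matprod m M) = \prod_(s <= a < s + m) mat N M a.
Proof.
rewrite rmorph_prod [in RHS](addnC s) -[in RHS](add0n s) big_addn addnK.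
by apply: eq_big_nat => a /andP[_ am]; rewrite addnC; apply: emb_mat.
Qed.

Lemma matprod_split N i j (H1 : (0 + i <= N)%N) (H2 : (i + j <= N)%N) M :
  N = (i + j)%N -> matprod N M = emb H1 (matprod i M) * emb H2 (matprod j M).
Proof.
by move=> eN; rewrite !emb_matprod -big_cat_nat ?eN //= leq_addr.
Qed.

Lemma to_mx_Mprod N M : to_mx (@Mprod Rg n N M) = matprod N M.
Proof.
rewrite /Mprod (big_morph _ (@to_mxM Rg n N) (@to_mx1 Rg n N)) /matprod big_mkord.
by apply: eq_bigr => a _; rewrite /mat posE.
Qed.

Variable A : 'M[CC]_(n * n).

Definition adj_op N := pos (fun x : 'I_N => to_mx (Padj Rg A x)).

Lemma emb_gen s m N (H : (s + m <= N)%N) a : (a.+1 < m)%N ->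
  emb H (adj_op m a) = adj_op N (s + a).
Proof.
move=> am; apply: emb_pos; first exact: ltnW.
move=> i /= ia; rewrite /Padj emb_emb2; congr (to_mx (emb2 _ _ _ _)).
apply: val_inj; rewrite /= !val_insubd /= ia am -addnS ifT //; lia.
Qed.

Lemma central_gen N a : central (adj_op N a).
Proof.
rewrite /adj_op /pos; case: insub => [x|] /=; first exact: central_emb2.
by move=> x; apply: commr1.
Qed.

Lemma comm_gen_mat N M a b : (a.+1 < N)%N -> (b < N)%N -> (b < a)%N || (a.+1 < b)%N ->
  GRing.comm (adj_op N a) (mat N M b).
Proof.
move=> aN bN ab; have H1 : (a + 2 <= N)%N by lia.
have H2 : (b + 1 <= N)%N by lia.
rewrite -(addn0 a) -(emb_gen H1) // -(addn0 b) -(emb_mat H2) //.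
apply: emb_comm; last exact: central_gen.
by move=> x; rewrite !outE; lia.
Qed.

Let a2 := to_mx (@emb2 Rg n 2 A ord0 ord_max).

Lemma prod_off2 (F : 'I_2 -> Rg) :
  \prod_(i : 'I_2 | (i != ord0) && (i != ord_max)) F i = 1.
Proof. by apply: big_pred0; case=> -[|[|]]. Qed.

Lemma tidx2_bij : bijective (fun K : tidx 2 => mxvec_index (K ord0) (K ord_max)).
Proof.
have [g gK Kg] := @curry_mxvec_bij n n.
exists (fun c => [ffun i : 'I_2 => if i == ord0 then (g c).1 else (g c).2]) => [K|c].
  apply/ffunP=> i; rewrite ffunE (gK (_, _)) //=.
  by case: eqP => [->//|/eqP i0]; congr (K _); case: i i0 => -[|[|]] // ? ?; apply: val_inj.
by rewrite !ffunE /= -{3}[c]Kg //; case: (g c).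
Qed.

Lemma mul_emb2 (X Y : 'M[CC]_(n * n)) :
  to_mx (@emb2 Rg n 2 X ord0 ord_max) * to_mx (emb2 Rg Y ord0 ord_max) =
  to_mx (emb2 Rg (X *m Y) ord0 ord_max).
Proof.
apply: of_mxP => I J; rewrite of_mxM /opmul !to_mxK /emb2 mxE.
under eq_bigr => K _ do rewrite !prod_off2 !mulr1.
rewrite prod_off2 mulr1 scaler_suml.
rewrite [RHS](reindex _ (onW_bij _ tidx2_bij)) /=.
by apply: eq_bigr => K _; rewrite -scalerAl mul1r scalerA.
Qed.

Lemma adj_op2E : adj_op 2 0 = to_mx (emb2 Rg (PA A) ord0 ord_max).
Proof.
rewrite /adj_op (posE _ (ord0 : 'I_2)) /Padj; congr (to_mx (emb2 _ _ _ _)).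
by apply: val_inj; rewrite val_insubd.
Qed.

Lemma adj_op2_sub : adj_op 2 0 = 1 - a2 *+ 2.
Proof.
rewrite adj_op2E; apply: of_mxP => I J.
have -> : of_mx (1 - a2 *+ 2) I J = (I == J)%:R - of_mx a2 I J *+ 2.
  by rewrite -of_mx1 /of_mx !mxE.
rewrite !to_mxK /emb2 !prod_off2.
rewrite !mulr1 /PA !mxE scalerBl -scalerA !scaler_nat; congr (_ - _).
by rewrite (inj_eq (bij_inj tidx2_bij)).
Qed.

Hypothesis A_idem : A *m A = A.

Let a2_idem : a2 * a2 = a2. Proof. by rewrite mul_emb2 A_idem. Qed.

(** Each relation is checked on the smallest block carrying it and then embedded: the square of
    [1 - 2A] is 1 by idempotence, the braid relation is the hypothesis on three factors, and distant
    generators act on disjoint blocks with scalar entries. *)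
Lemma coxeter_gen N : braid Rg (PA A) -> coxeter 1 *%R (adj_op N) N.-1.
Proof.
move=> br; split=> [a aN|a aN|a b ab bN].
- have H : (a + 2 <= N)%N by lia.
  rewrite -(addn0 a) -(emb_gen H) // -rmorphM -[RHS](rmorph1 (emb H)) adj_op2_sub /=.
  congr (emb H _); rewrite mulrBl mul1r mulrBr mulr1 mulrnAl mulrnAr a2_idem.
  by rewrite mulr2n opprB addrK subrK.
- have H : (a + 3 <= N)%N by lia.
  rewrite -(addn0 a) -(emb_gen H) // -addnS -(emb_gen H) // -!rmorphM /=.
  congr (emb H _); move: br => /(congr1 (@to_mx Rg n 3)); rewrite !to_mxM.
  have -> : to_mx (@emb2 Rg n 3 (PA A) 0 1) = adj_op 3 0.
    rewrite /adj_op -[0%N]/(val (0 : 'I_3)) posE /Padj; congr (to_mx (emb2 _ _ _ _)).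
    by apply: val_inj; rewrite val_insubd.
  suff -> : to_mx (@emb2 Rg n 3 (PA A) 1 2) = adj_op 3 1 by [].
  rewrite /adj_op -[1%N]/(val (1 : 'I_3)) posE /Padj; congr (to_mx (emb2 _ _ _ _)).
  by apply: val_inj; rewrite val_insubd.
- have H1 : (a + 2 <= N)%N by lia.
  have H2 : (b + 2 <= N)%N by lia.
  rewrite -(addn0 a) -(emb_gen H1) // -(addn0 b) -(emb_gen H2) //.
  apply: emb_comm; last exact: central_gen.
  by move=> x; rewrite !outE; lia.
Qed.

(** On two factors [1 + P_A] is [2(1 - A)], so the Manin relation removes the [A] part of the left
    [P_A = 1 - 2A]. The other factors of [M_1 ... M_N] commute with the generator. *)
Lemma manin_gen N M a : manin A M -> (a.+1 < N)%N ->
  adj_op N a * matprod N M * (1 + adj_op N a) = matprod N M * (1 + adj_op N a).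
Proof.
move=> /(congr1 (@to_mx Rg n 2)) mn aN; have H : (a + 2 <= N)%N by lia.
have mn2 : adj_op 2 0 * matprod 2 M * (1 + adj_op 2 0) = matprod 2 M * (1 + adj_op 2 0).
  have M2 : matprod 2 M = to_mx (emb1 M ord0) * to_mx (emb1 M ord_max).
    rewrite /matprod big_mkord !big_ord_recl big_ord0 mulr1 /mat !posE.
    by congr (_ * to_mx (emb1 _ _)); apply: val_inj.
  have {mn} : a2 * matprod 2 M * (1 - a2) = 0.
    move: mn; rewrite !to_mxM -/a2 M2 mulrA => mn0.
    transitivity (to_mx (@opzero Rg n 2)); last by apply/matrixP=> i j; rewrite !mxE.
    rewrite -mn0; congr (_ * _); apply/matrixP=> i j.
    by rewrite /a2 !mxE /opsub /opone (inj_eq enum_val_inj).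
  rewrite adj_op2_sub => mn0; have -> : 1 + (1 - a2 *+ 2) = (1 - a2) *+ 2.
    by rewrite addrA -mulr2n mulrnBl.
  rewrite !mulrnAr; congr (_ *+ _).
  by rewrite mulrBl mul1r mulrBl mulrnAl mulrnAl mn0 mul0rn subr0.
have gE : adj_op N a = emb H (adj_op 2 0) by rewrite emb_gen ?addn0.
have -> : matprod N M = \prod_(0 <= b < a) mat N M b * emb H (matprod 2 M) *
    \prod_(a + 2 <= b < N) mat N M b.
  by rewrite emb_matprod -!big_cat_nat //= leq_addr.
have commL : GRing.comm (adj_op N a) (\prod_(0 <= b < a) mat N M b).
  by rewrite big_nat; apply: commr_prod => b ba; apply: comm_gen_mat => //; lia.
have commR : GRing.comm (adj_op N a) (\prod_(a + 2 <= b < N) mat N M b).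
  by rewrite big_nat; apply: commr_prod => b ba; apply: comm_gen_mat => //; lia.
have commR' : GRing.comm (1 + adj_op N a) (\prod_(a + 2 <= b < N) mat N M b).
  by apply/commr_sym/commrD; [apply: commr1 | apply: commr_sym].
rewrite !mulrA commL -!mulrA -commR' [in LHS](mulrA (emb H _)) [in LHS](mulrA (adj_op N a)).
rewrite [in LHS](mulrA (adj_op N a)) [in RHS](mulrA (emb H _)); congr (_ * (_ * _)).
by rewrite gE -(rmorph1 (emb H)) -rmorphD -!rmorphM /= mn2.
Qed.

End Generators.

(** * Traces of the powers *)

(** For adjacent transpositions this is a cycle on the first [j+1] points. *)
Definition desc_prod (B : pzRingType) (p : nat -> B) := fix D j : B :=
  if j is j'.+1 then p j' * D j' else 1.

Lemma desc_prod_rmorph (B B' : pzRingType) (f : {rmorphism B -> B'}) p p' j :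
  (forall a, (a < j)%N -> f (p a) = p' a) -> f (desc_prod p j) = desc_prod p' j.
Proof.
elim: j => [|j IH] fp /=; first by rewrite rmorph1.
by rewrite rmorphM fp // IH // => a aj; apply/fp/ltnW.
Qed.

Lemma desc_prod_recr (B : pzRingType) (p : nat -> B) j :
  desc_prod p j.+1 = desc_prod (fun a => p a.+1) j * p 0%N.
Proof.
elim: j => [|j IH]; first by rewrite /= mulr1 mul1r.
by rewrite -[LHS]/(p j.+1 * desc_prod p j.+1) IH /= mulrA.
Qed.

Section PowerTraces.
Variables (Rg : algType CC) (n : nat).
Notation tidx := (tidx n).
Notation opmx := (opmx Rg n).

Lemma of_mx_sum k (T : finType) (F : T -> opmx k) I J :
  of_mx (\sum_i F i) I J = \sum_i of_mx (F i) I J.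
Proof. by rewrite /of_mx summxE. Qed.

Lemma opmx_scaleAl k a (X Y : opmx k) : (a *: X) * Y = a *: (X * Y).
Proof. exact/esym/scalemxAl. Qed.

Lemma of_mat1 (X : 'M[Rg]_n) I J : of_mx (mat 1 X 0%N) I J = X (I ord0) (J ord0).
Proof.
rewrite /mat (posE _ (ord0 : 'I_1)) to_mxK /emb1 big_pred0 ?mulr1 // => i.
by rewrite ord1 eqxx.
Qed.

Lemma sum_tidx1 (F : 'I_n -> Rg) : \sum_(K : tidx 1) F (K ord0) = \sum_c F c.
Proof.
rewrite (reindex_onto (fun c => [ffun=> c]) (fun K : tidx 1 => K ord0)) /=.
  by apply: eq_big => c; rewrite ffunE ?eqxx.
by move=> K _; apply/ffunP=> i; rewrite ffunE (ord1 i).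
Qed.

Lemma tr_mat1 (X : 'M[Rg]_n) : \tr (mat 1 X 0%N) = \tr X.
Proof.
by rewrite tr_of_mx /mxtrace -sum_tidx1; apply: eq_bigr => K _; rewrite of_mat1.
Qed.

Lemma mat_emb1 N (X : 'M[Rg]_n) a (H : (a + 1 <= N)%N) :
  mat N X a = emb H (mat 1 X 0%N).
Proof. by rewrite emb_mat // addn0. Qed.

Lemma matM N (X Y : 'M[Rg]_n) a : (a < N)%N ->
  mat N X a * mat N Y a = mat N (X *m Y) a.
Proof.
rewrite -addn1 => H; rewrite !(mat_emb1 _ H) -rmorphM; congr (emb H _).
apply: of_mxP => I J; rewrite of_mat1 of_mxM /opmul mxE -sum_tidx1.
by apply: eq_bigr => K _; rewrite !of_mat1.
Qed.

Lemma central_delta N a b c : central (mat N (delta_mx a b : 'M[Rg]_n) c).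
Proof.
rewrite /mat /pos; case: insub => [x|] /=; last by move=> x; apply: commr1.
apply/centralP=> I J y; rewrite to_mxK /emb1 prod_agree mxE -natrM.
by rewrite mulr_natl mulr_natr.
Qed.

Lemma sum_mat_delta N c : (c < N)%N ->
  \sum_(a < n) mat N (delta_mx a a : 'M[Rg]_n) c = 1.
Proof.
rewrite -addn1 => H; rewrite -[RHS](rmorph1 (emb H)).
under eq_bigr => a _ do rewrite (mat_emb1 _ H).
rewrite -raddf_sum; congr (emb H _); apply: of_mxP => I J.
rewrite of_mx1.
have -> : (I == J) = (I ord0 == J ord0).
  apply/eqP/eqP => [->//|IJ]; apply/ffunP=> i; by rewrite (ord1 i).
transitivity ((1%:M : 'M[Rg]_n) (I ord0) (J ord0)); last by rewrite mxE.
rewrite mx1_sum_delta /of_mx !summxE; apply: eq_bigr => a _.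
by rewrite -of_mat1.
Qed.

Variable A : 'M[CC]_(n * n).
Local Notation gen := (adj_op Rg A).
Local Notation P a b c d := (PA A (mxvec_index a b) (mxvec_index c d)).

(** Expanding [P_A] in matrix units separates the two tensor factors, so that the trace in
    [Mbr_entry] splits. *)
Lemma adj_op2_sum : gen 2 0 = \sum_(a < n) \sum_(b < n) \sum_(i < n) \sum_(c < n)
  (P a i b c)%:A *: (mat 2 (delta_mx a b) 0%N * mat 2 (delta_mx i c) 1%N).
Proof.
have H0 : (0 + 1 <= 2)%N by []. have H1 : (1 + 1 <= 2)%N by [].
apply: of_mxP => I J.
rewrite adj_op2E to_mxK /emb2 prod_off2 mulr1.
have E a b i c : of_mx (mat 2 (delta_mx a b : 'M[Rg]_n) 0%N * mat 2 (delta_mx i c) 1%N) I J =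
    ((I ord0 == a) && (J ord0 == b) && ((I ord_max == i) && (J ord_max == c)))%:R.
  rewrite (mat_emb1 _ H0) (mat_emb1 _ H1) emb_mul_disjoint; last first.
    by move=> x; rewrite !outE; lia.
  have -> : agree (predI (out H0) (out H1)) I J.
    by apply/agreeP=> x /=; rewrite !outE; have := ltn_ord x; lia.
  rewrite mulr1 !of_mat1 !mxE !ffunE -natrM mulnb.
  have -> : shift H0 ord0 = ord0 by apply: val_inj.
  by have -> : shift H1 ord0 = ord_max by apply: val_inj.
rewrite of_mx_sum (bigD1 (I ord0)) //= [X in _ + X]big1 ?addr0; last first.
  move=> a aI; rewrite of_mx_sum big1 // => b _; rewrite of_mx_sum big1 // => i _.
  rewrite of_mx_sum big1 // => c _; rewrite of_mxZ E.
  by rewrite eq_sym (negPf aI) mulr0.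
rewrite of_mx_sum (bigD1 (J ord0)) //= [X in _ + X]big1 ?addr0; last first.
  move=> b bJ; rewrite of_mx_sum big1 // => i _.
  rewrite of_mx_sum big1 // => c _; rewrite of_mxZ E.
  by rewrite [J _ == b]eq_sym (negPf bJ) andbF mulr0.
rewrite of_mx_sum (bigD1 (I ord_max)) //= [X in _ + X]big1 ?addr0; last first.
  move=> i iI; rewrite of_mx_sum big1 // => c _; rewrite of_mxZ E.
  by rewrite [I _ == i]eq_sym (negPf iI) andbF mulr0.
rewrite of_mx_sum (bigD1 (J ord_max)) //= [X in _ + X]big1 ?addr0; last first.
  move=> c cJ; rewrite of_mxZ E.
  by rewrite [J _ == c]eq_sym (negPf cJ) !andbF mulr0.
by rewrite of_mxZ E !eqxx mulr1.
Qed.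

(* M^{[k+1]} is the partial trace over the first k factors, whose entries are
   extracted by a matrix unit acting on the last one. *)
Lemma Mbr_entry (M : 'M[Rg]_n) k x y :
  Mbr A M k.+1 y x =
  \tr (mat k.+1 (delta_mx x y) k * (desc_prod (gen k.+1) k * matprod k.+1 M)).
Proof.
have tr_delta (C : 'M[Rg]_n) i c : \tr (delta_mx i c *m C) = C c i.
  rewrite /mxtrace (bigD1 i) //= big1 ?addr0 => [|j ji]; rewrite mxE.
    rewrite (bigD1 c) //= big1 ?addr0 => [|d dc]; rewrite mxE !eqxx ?mul1r //.
    by rewrite (negPf dc) mul0r.
  by apply: big1 => d _; rewrite mxE (negPf ji) mul0r.
elim: k x y => [|k IH] x y.
  by rewrite /= mul1r /matprod big_nat1 matM // tr_mat1 tr_delta.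
have H1 : (0 + k.+1 <= k.+2)%N by lia.
have H2 : (k.+1 + 1 <= k.+2)%N by lia.
have H3 : (k + 2 <= k.+2)%N by lia.
(* Only the leading generator touches the last factor; [Z] collects what lives on the first [k.+1]
   factors and is the operator of the induction hypothesis. *)
pose Z := desc_prod (gen k.+1) k * matprod k.+1 M.
have ZE : desc_prod (gen k.+2) k.+1 * matprod k.+2 M = gen k.+2 k * (emb H1 Z * mat k.+2 M k.+1).
  rewrite /= -mulrA; congr (_ * _).
  rewrite (matprod_split H1 H2) ?addn1 // mulrA rmorphM; congr (_ * _ * _).
    symmetry; apply: desc_prod_rmorph => a ak; rewrite /= emb_gen ?add0n //.
  by rewrite /matprod big_nat1 -mat_emb1.
(* The matrix unit has scalar entries, so it can be cycled to the right end and merged with the last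
   [M]. *)
rewrite ZE tr_mulC; last exact: central_delta.
have gE : gen k.+2 k = emb H3 (gen 2 0) by rewrite emb_gen // addn0.
rewrite -!mulrA matM // gE adj_op2_sum.
transitivity (\sum_(a < n) \sum_(b < n) \sum_(i < n) \sum_(c < n)
  (P a i b c)%:A * (Mbr A M k.+1 b a * (M *m delta_mx x y) c i)).
  rewrite -[Mbr A M k.+2]/(mstar A (Mbr A M k.+1) M) mxE.
  apply: eq_bigr => a _; apply: eq_bigr => b _.
  rewrite [RHS](bigD1 y) //= [X in _ + X]big1 ?addr0 => [|i iy]; last first.
    apply: big1 => c _; rewrite [(M *m _) _ _]mxE big1 ?mulr0 // => d _.
    by rewrite mxE (negPf iy) andbF mulr0.
  apply: eq_bigr => c _; congr (_ * (_ * _)).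
  rewrite mxE (bigD1 x) //= big1 ?addr0 => [|d dx]; rewrite mxE ?eqxx ?mulr1 //.
  by rewrite (negPf dx) mulr0.
rewrite raddf_sum mulr_suml raddf_sum; apply: eq_bigr => a _.
rewrite raddf_sum mulr_suml raddf_sum; apply: eq_bigr => b _.
rewrite raddf_sum mulr_suml raddf_sum; apply: eq_bigr => i _.
rewrite raddf_sum mulr_suml raddf_sum; apply: eq_bigr => c _.
rewrite /= embZ opmx_scaleAl mxtraceZ rmorphM /= !emb_mat // addn0 addn1; congr (_ * _).
have -> : mat k.+2 (delta_mx a b : 'M[Rg]_n) k = emb H1 (mat k.+1 (delta_mx a b) k).
  by rewrite emb_mat.
have cX : GRing.comm (mat k.+2 (delta_mx i c : 'M[Rg]_n) k.+1) (emb H1 Z).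
  rewrite (mat_emb1 _ H2); apply: emb_comm; last exact: central_delta.
  by move=> u; rewrite !outE; lia.
rewrite -mulrA (mulrA (mat _ (delta_mx i c) _)) cX -mulrA matM // mulrA -rmorphM (mat_emb1 _ H2).
by rewrite tr_emb_mul ?addn1 // IH tr_mat1 tr_delta.
Qed.

(** Sum the diagonal entries: the diagonal matrix units add up to the identity. *)
Lemma tr_Mbr (M : 'M[Rg]_n) k :
  \tr (Mbr A M k.+1) = \tr (desc_prod (gen k.+1) k * matprod k.+1 M).
Proof.
under [LHS]eq_bigr => a _ do rewrite Mbr_entry.
by rewrite -raddf_sum -mulr_suml sum_mat_delta // mul1r.
Qed.

End PowerTraces.

(** * Identification of the symmetrizers *)

Lemma coxeterN (B : pzRingType) (p : nat -> B) k :
  coxeter 1 *%R p k -> coxeter 1 *%R (fun a => - p a) k.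
Proof.
case=> p2 pb pc; split=> [a ak|a ak|a b ab bk]; rewrite ?mulrNN; [exact: p2| |exact: pc].
by rewrite !mulrN pb.
Qed.

Lemma coxeter_shift (X : Type) (e : X) op p k l m :
  (forall a, a < l -> m + a < k)%N ->
  coxeter e op p k -> coxeter e op (fun a => p (m + a)%N) l.
Proof.
move=> mk [p2 pb pc]; split=> [a al|a al|a b ab bl].
- by apply: p2; apply: mk.
- by rewrite addnS; apply: pb; rewrite -addnS; apply: mk.
- by apply: pc; [lia | apply: mk].
Qed.

Lemma coxeter_rev (X : Type) (e : X) op p k :
  coxeter e op p k -> coxeter e op (fun a => p (k.-1 - a)%N) k.
Proof.
move=> [p2 pb pc]; split=> [a ak|a ak|a b ab bk].
- by apply: p2; lia.
- have -> : (k.-1 - a = (k.-1 - a.+1).+1)%N by lia.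
  by rewrite -pb //; lia.
- by rewrite -pc //; lia.
Qed.

Lemma desc_prod_neg (B : pzRingType) (p : nat -> B) j :
  desc_prod (fun a => - p a) j = (-1) ^+ j * desc_prod p j.
Proof.
elim: j => [|j IH] /=; first by rewrite mul1r.
by rewrite IH exprS mulN1r !mulNr (mulrA (p j)) (commr_sign (p j)) -mulrA.
Qed.

Lemma eq_desc_prod (B : pzRingType) (p q : nat -> B) j : p =1 q -> desc_prod p j = desc_prod q j.
Proof. by move=> pq; elim: j => //= j ->; rewrite pq. Qed.

Lemma natS_CC_neq0 m : (m.+1%:R : CC) != 0.
Proof. by rewrite (pnatr_eq0 (complex Rdefinitions.R)). Qed.

Section Link.
Variables (Rg : algType CC) (n : nat).
Notation opmx := (opmx Rg n).

Definition rinv N (m : nat) : opmx N := ((m.+1%:R^-1 : CC)%:A : Rg)%:M.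

Lemma inv_succ_rinv N : inv_succ (rinv N).
Proof.
split=> [m X|m].
  apply: of_mxP => I J; rewrite of_mx_scalarl of_mx_scalarr.
  by rewrite mulr_algl mulr_algr.
rewrite mulr_natr -raddfMn /= scalerMnl -mulr_natr mulVf ?natS_CC_neq0 //.
by rewrite scale1r.
Qed.

Lemma emb_rinv s m N (H : (s + m <= N)%N) a : emb H (rinv m a) = rinv N a.
Proof. exact: emb_scalar. Qed.

Lemma central_sym N (p : nat -> opmx N) m :
  (forall a, central (p a)) -> central (sym (rinv N) p m).
Proof. by move=> cp x; apply: (comm_sym (inv_succ_rinv N)) => a _; apply: cp. Qed.

Lemma word_permE k (w : seq 'I_k.+1) : valid_word w ->
  word_perm w = (\prod_(a <- map val w) adj_tperm k a)%g.
Proof.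
rewrite /word_perm big_map; elim: w => [|a w IH] /=; first by rewrite !big_nil.
move=> /andP[ak /IH wE]; rewrite !big_cons wE /adj_tperm inord_val.
congr (tperm _ _ * _)%g; apply: val_inj.
by rewrite /= val_insubd ak inordK.
Qed.

Definition perm_word k (s : 'S_k) := epsilon (inhabits [::])
  (fun w : seq 'I_k => valid_word w /\ word_perm w = s).

Lemma perm_wordP k (s : 'S_k.+1) :
  valid_word (perm_word s) /\ word_perm (perm_word s) = s.
Proof.
apply: (epsilon_spec (inhabits [::])
  (fun w : seq 'I_k.+1 => valid_word w /\ word_perm w = s)).
have [w wk ws] := adj_word_ex s; exists (map inord w).
have vw : valid_word [seq (inord i : 'I_k.+1) | i <- w].
  rewrite /valid_word all_map; apply: sub_all wk => a ak /=.
  by rewrite inordK ?ltnS // ltnW.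
split=> //; rewrite word_permE // -map_comp -ws; congr (\prod_(_ <- _) _)%g.
rewrite -[RHS]map_id; apply/eq_in_map => a /(allP wk) ak /=.
by rewrite inordK // ltnS ltnW.
Qed.

(** Covers both symmetrizers at once; for [Altk] the signs are put into the generators. *)
Lemma to_mx_sum_words k (p : nat -> opmx k) (X : 'S_k -> top Rg n k) :
  coxeter 1 *%R p k.-1 ->
  (forall s, to_mx (X s) = \prod_(a <- map val (perm_word s)) p a) ->
  to_mx (fun I J => (k`!%:R^-1 : CC) *: \sum_s X s I J) = sym (rinv k) p k.
Proof.
move=> cp XE.
have -> : to_mx (fun I J => (k`!%:R^-1 : CC) *: \sum_s X s I J) =
    (k`!%:R^-1 : CC)%:A *: \sum_s to_mx (X s).
  apply/matrixP=> i j; rewrite !mxE summxE mulr_algl; congr (_ *: _).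
  by apply: eq_bigr => s _; rewrite mxE.
have -> : \sum_s to_mx (X s) = sym (rinv k) p k *+ k`!.
  under eq_bigr => s _ do rewrite XE.
  case: k p {X XE} cp => [|k] p cp.
    (* For [k = 0] the chosen word has letters in the empty type ['I_0], hence is empty. *)
    rewrite (eq_bigr (fun=> 1)) => [|s _]; last first.
      by case: (perm_word s) => [|[]//]; rewrite big_nil.
    by rewrite sumr_const card_Sn.
  apply: sum_words => // [|s]; first exact: inv_succ_rinv.
  have [vw ws] := perm_wordP s; rewrite -word_permE //; split=> //.
  by rewrite all_map.
rewrite -scalerMnr !scalerMnl -mulr_natr mulVf ?scale1r ?scale1r //.
by rewrite -(prednK (fact_gt0 k)) natS_CC_neq0.
Qed.

Variable A : 'M[CC]_(n * n).
Hypotheses (A_idem : A *m A = A) (br : braid Rg (PA A)).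
Local Notation gen := (adj_op Rg A).

Lemma to_mx_Pperm k (s : 'S_k) :
  to_mx (Pperm Rg A s) = \prod_(a <- map val (perm_word s)) gen k a.
Proof.
rewrite /Pperm -/(perm_word s) (big_morph _ (@to_mxM Rg n k) (@to_mx1 Rg n k)) big_map.
by apply: eq_bigr => a _; rewrite /adj_op posE.
Qed.

Lemma to_mx_Symk k : to_mx (@Symk Rg n k A) = sym (rinv k) (gen k) k.
Proof. by apply: to_mx_sum_words; [exact: coxeter_gen|exact: to_mx_Pperm]. Qed.

Lemma odd_word_perm k (w : seq 'I_k) : valid_word w -> odd_perm (word_perm w) = odd (size w).
Proof.
rewrite /word_perm; elim: w => [|a w IH] /=; first by rewrite big_nil odd_perm1.
move=> /andP[ak /IH wE]; rewrite big_cons odd_permM wE odd_tperm.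
suff -> : a != nxt a by [].
by apply/eqP=> /(congr1 val); rewrite val_insubd ak /=; lia.
Qed.

(** The sign of a permutation is the parity of the length of any word for it, so it distributes as
    one minus sign per generator. *)
Lemma to_mx_Altk k : to_mx (@Altk Rg n k A) = sym (rinv k) (fun a => - gen k a) k.
Proof.
apply: (to_mx_sum_words
  (X := fun s I J => ((-1) ^+ odd_perm s : CC) *: Pperm Rg A s I J)).
  exact/coxeterN/coxeter_gen.
move=> s; have -> : odd_perm s = odd (size (perm_word s)).
  case: k s => [|k] s; last by have [/odd_word_perm <- ->] := perm_wordP s.
  case: (perm_word s) => [|[]//]; rewrite (_ : s = 1%g) ?odd_perm1 //.
  by apply/permP=> -[].
have -> : to_mx (fun I J => ((-1) ^+ odd (size (perm_word s)) : CC) *: Pperm Rg A s I J) =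
    (-1) ^+ size (perm_word s) * to_mx (Pperm Rg A s).
  rewrite -[in RHS]signr_odd; case: (odd _); rewrite /= ?expr0 ?expr1 ?mulN1r ?mul1r.
    by apply/matrixP=> i j; rewrite !mxE scaleN1r.
  by apply/matrixP=> i j; rewrite !mxE scale1r.
rewrite to_mx_Pperm !big_map; elim: (perm_word s) => [|a w IH].
  by rewrite !big_nil mulr1.
by rewrite !big_cons -IH /= exprS mulN1r !mulNr (mulrA (gen k a)) (commr_sign (gen k a)) -mulrA.
Qed.
End Link.

(** * Newton identities *)

Section NewtonIdentities.
Variables (Rg : algType CC) (n : nat) (A : 'M[CC]_(n * n)) (M : 'M[Rg]_n).
Hypotheses (A_idem : A *m A = A) (br : braid Rg (PA A)) (mn : manin A M).
Local Notation gen := (adj_op Rg A).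
Local Notation rinv := (@rinv Rg n).

(** The coefficient of [A(t)] without its factor [(-1)^k]. *)
Definition altc k := trk (opmul (@Altk Rg n k A) (@Mprod Rg n k M)).

Lemma SserE k : Sser A M k = \tr (sym (rinv k) (gen k) k * matprod k M).
Proof. by rewrite /Sser trk_to_mx to_mxM to_mx_Symk // to_mx_Mprod. Qed.

Lemma altcE k :
  altc k = \tr (sym (rinv k) (fun a => - gen k a) k * matprod k M).
Proof. by rewrite /altc trk_to_mx to_mxM to_mx_Altk // to_mx_Mprod. Qed.

Let cg N : coxeter 1 *%R (gen N) N.-1 := coxeter_gen A_idem N br.
Let trD N : {morph @mxtrace Rg #|{: tidx n N}| : x y / x + y}.
Proof. exact: mxtraceD. Qed.

Lemma central_desc_prod N (p : nat -> opmx Rg n N) j :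
  (forall a, central (p a)) -> central (desc_prod p j).
Proof.
move=> cp x; elim: j => [|j IH] /=; first exact: commr1.
by apply: commrM => //; apply: cp.
Qed.

Lemma newton_Sser N :
  Sser A M N *+ N = \sum_(m < N) Tser A M (N - m.+1)%N * Sser A M m.
Proof.
(* With the generators reversed, [E m] acts on the last [m] factors and the cycle on the first
   [N - m], which puts the power trace to the left of the symmetric one. *)
pose q a := gen N (N.-2 - a).
have cq : coxeter 1 *%R q N.-1 := coxeter_rev (cg N).
have rN := inv_succ_rinv Rg n N.
pose Pi m := desc_prod (gen N) (N - m).
rewrite SserE -(@sym_rev _ _ (gen N) q) //; last exact: cg.
rewrite (@newton _ _ q N rN cq _ _ (@trD N) _ (matprod N M) _ Pi).
- apply: eq_bigr => m _; have mN := ltn_ord m.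
  have [j Nj] : exists j, N = (j.+1 + m)%N by exists (N - m.+1)%N; lia.
  have H1 : (0 + j.+1 <= N)%N by lia.
  have H2 : (j.+1 + m <= N)%N by lia.
  have -> : sym (rinv N) q m = emb H2 (sym (rinv m) (gen m) m).
    rewrite (@sym_rmorph _ _ (emb H2) _ _ (rinv N) (fun a => gen N (j.+1 + a)%N)).
    + apply: sym_rev => //.
      * by apply: coxeter_shift (cg N) => a; lia.
      * by apply: coxeter_leq cq; lia.
      * by move=> a am; congr (gen N _); lia.
    + by move=> a; apply: emb_rinv.
    + by move=> a am; apply: emb_gen.
  have -> : Pi m.+1 = emb H1 (desc_prod (gen j.+1) j).
    rewrite /Pi (_ : N - m.+1 = j)%N; last by lia.
    by symmetry; apply: desc_prod_rmorph => a aj; apply: emb_gen.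
  rewrite (matprod_split H1 H2) // -mulrA (mulrA (emb H1 _)) -rmorphM mulrA.
  have -> : GRing.comm (emb H2 (sym (rinv m) (gen m) m))
      (emb H1 (desc_prod (gen j.+1) j * matprod j.+1 M)).
    apply: emb_comm; last by apply: central_sym => a; apply: central_gen.
    by move=> x; rewrite !outE; have := ltn_ord x; lia.
  rewrite -mulrA -rmorphM tr_emb_mul // SserE /Tser tr_Mbr.
  by rewrite (_ : N - m.+1 = j)%N //; lia.
- by move=> a x aN; apply/tr_mulC/central_gen.
- by move=> a aN; apply: manin_gen => //; lia.
- by rewrite /Pi subnn.
- by move=> m mN; rewrite /Pi /q -(subnSK mN) /= ; congr (gen N _ * _); lia.
Qed.

Lemma newton_alt N :
  altc N *+ N = \sum_(m < N) (-1) ^+ (N - m.+1) * (altc m * Tser A M (N - m.+1)%N).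
Proof.
pose q a := - gen N a.
have cq : coxeter 1 *%R q N.-1 := coxeterN (cg N).
have rN := inv_succ_rinv Rg n N.
have centq a : central (q a).
  by move=> x; apply/commrN/central_gen.
pose Pi m := desc_prod (fun a => q (m.-1 + a)%N) (N - m).
(* Products are read backwards in the converse ring, so the symmetrizer is first brought to the
   right of [M_1 ... M_N]. *)
rewrite altcE tr_mulC; last exact: central_sym.
rewrite -(sym_converse rN cq).
have := @newton (opmx Rg n N)^c _ q N (inv_succ_converse rN) (coxeter_converse cq)
  _ _ (@trD N) _ (matprod N M) _ Pi.
move=> -> //.
- apply: eq_bigr => m _; have mN := ltn_ord m.
  (* Here [E m] acts on the first [m] factors and the cycle on the last [j.+1]; its [j] negated
     generators give the sign [(-1)^j]. *)
  have [j Nj] : exists j, N = (m + j.+1)%N by exists (N - m.+1)%N; lia.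
  rewrite sym_converse //; last by apply: coxeter_leq cq; lia.
  rewrite -[X in \tr X = _]/(matprod N M * (Pi m.+1 * sym (rinv N) q m)).
  rewrite -tr_mulC; last first.
    by move=> x; apply: commrM; [exact: central_desc_prod | exact: central_sym].
  have H1 : (0 + m <= N)%N by lia.
  have H2 : (m + j.+1 <= N)%N by lia.
  have -> : sym (rinv N) q m = emb H1 (sym (rinv m) (fun a => - gen m a) m).
    symmetry; apply: sym_rmorph => a; first exact: emb_rinv.
    by move=> am; rewrite rmorphN /= emb_gen.
  have -> : Pi m.+1 = (-1) ^+ j * emb H2 (desc_prod (gen j.+1) j).
    rewrite /Pi (_ : N - m.+1 = j)%N; last by lia.
    rewrite desc_prod_neg; congr (_ * _); symmetry; apply: desc_prod_rmorph => a aj.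
    exact: emb_gen.
  rewrite (matprod_split H1 H2) // -!mulrA.
  have -> : forall X : opmx Rg n N, \tr ((-1) ^+ j * X) = (-1) ^+ j * \tr X.
    by move=> X; rewrite -signr_odd -[in RHS]signr_odd; case: odd;
      rewrite ?mulN1r ?mul1r // raddfN.
  rewrite (mulrA (emb H1 _)) -rmorphM mulrA.
  have -> : GRing.comm (emb H2 (desc_prod (gen j.+1) j))
      (emb H1 (sym (rinv m) (fun a => - gen m a) m * matprod m M)).
    apply: emb_comm; last by apply: central_desc_prod => a; apply: central_gen.
    by move=> x; rewrite !outE; have := ltn_ord x; lia.
  rewrite -mulrA -rmorphM tr_emb_mul // altcE /Tser tr_Mbr.
  by rewrite (_ : N - m.+1 = j)%N //; lia.
- by move=> a x aN; apply/esym/tr_mulC.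
(* In the converse ring the required relation reads [(1 - P) M (1 + P) = 0] with [P = P_A], which is
   the same Manin relation seen from the other side. *)
- move=> a aN; have mg := manin_gen mn aN.
  suff : (1 + q a) * (matprod N M * q a) = (1 + q a) * matprod N M by [].
  apply/esym/subr0_eq; rewrite mulrA -{1}[_ * matprod N M]mulr1 -mulrBr opprK.
  by rewrite mulrBl mul1r mulrBl mg subrr.
- by rewrite /Pi subnn.
- move=> m mN; rewrite /Pi -(subnSK mN) desc_prod_recr addn0.
  by rewrite (@eq_desc_prod _ _ (fun a => q (m.+1 + a)%N)) // => a; rewrite addSnnS.
Qed.

End NewtonIdentities.

Theorem mainTheorem16 (Rg : algType CC) (n : nat) (A : 'M[CC]_(n * n))
    (M : 'M[Rg]_n) :
  A *m A = A ->
  braid Rg (PA A) ->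
  manin A M ->
  fps_deriv (Aser A M) = fps_opp (fps_mul (Aser A M) (Tser A M)) /\
  fps_deriv (Sser A M) = fps_mul (Tser A M) (Sser A M).
Proof.
move=> A_idem br mn; split; apply: functional_extensionality => k; rewrite /fps_deriv.
  rewrite /fps_opp /fps_mul /Aser -mulrnAr -/(altc A M k.+1) newton_alt // mulr_sumr -sumrN.
  apply: eq_bigr => m _; have mk := ltn_ord m.
  rewrite -/(altc A M m) subSS !mulrA -!mulNr; congr (_ * _ * _).
  (* The signs combine as [(-1)^(k+1) (-1)^(k-m) = -(-1)^m]. *)
  rewrite -exprD -[RHS]mulN1r -exprS -[LHS]signr_odd -[RHS]signr_odd.
  by have -> : odd (k.+1 + (k - m)) = odd m.+1 by lia.
(* The recursion is indexed by the degree in [S], the Cauchy product by the degree in [T]. *)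
rewrite newton_Sser // (reindex_inj rev_ord_inj) /fps_mul; apply: eq_bigr => m _ /=.
by have mk := ltn_ord m; congr (Tser A M _ * Sser A M _); lia.
Qed.
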